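(* Let $\mathbb{X}$ be an arbitrary set. If a mapping $\rho:\mathbb{X}\times\mathbb{X}\to\mathbb{R}$ is the non-centered covariance of a random field on $\mathbb{X}$ with values in $[-1,1]$, then the following conditions hold: 1. Symmetry: $\rho(x,y)=\rho(y,x)$ for any $x,y\in\mathbb{X}$. 2. Boundedness: $\rho(x,y)\in[-1,1]$ for any $x,y\in\mathbb{X}$. 3. Positive semidefiniteness: for any positive integer $n$, any points $x_1,\ldots,x_n$ in $\mathbb{X}$ and any real numbers $\lambda_1,\ldots,\lambda_n$, $$\sum_{k=1}^n\sum_{\ell=1}^n\lambda_k\,\lambda_\ell\,\rho(x_k,x_\ell)\geq0.$$ These conditions are necessary but not sufficient: there exist a set $\mathbb{X}$ and a mapping $\rho:\mathbb{X}\times\mathbb{X}\to\mathbb{R}$ satisfying conditions 1, 2 and 3 that is not the non-centered covariance of any random field on $\mathbb{X}$ with values in $[-1,1]$.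
   Context: A random field on $\mathbb{X}$ valued in $\mathcal{E}\subseteq\mathbb{R}$ is a collection $Z=\{Z(x,\cdot):x\in\mathbb{X}\}$ of $\mathcal{E}$-valued random variables defined on a same probability space. Its non-centered covariance is $\rho(x,y)=\mathbb{E}[Z(x,\cdot)Z(y,\cdot)]$, $x,y\in\mathbb{X}$. *)

(* Defs.v *)
From HB Require Import structures.
From mathcomp Require Import all_boot all_order all_algebra.
From mathcomp Require Import all_classical all_reals all_analysis.

Set Implicit Arguments.
Unset Strict Implicit.
Unset Printing Implicit Defensive.

Import Order.TTheory GRing.Theory Num.Theory.
Import numFieldNormedType.Exports.

Local Open Scope classical_set_scope.
Local Open Scope ring_scope.

(* The random variables [rf_val x] are maps on the common probability space
   [rf_prob] taking all their values in [E]; measurability into [E] with its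
   trace Borel sigma-algebra is the same as measurability into [R]. *)
Record random_field (R : realType) (X : Type) (E : set R) := RandomField {
  rf_disp : measure_display;
  rf_space : measurableType rf_disp;
  rf_prob : probability rf_space R;
  rf_val : X -> {RV rf_prob >-> R};
  rf_valued : forall x w, E (rf_val x w)
}.

(* The expectation lives in [\bar R]; equating it with a real number contains
   the requirement that it exists and is finite. *)
Definition is_noncentered_covariance (R : realType) (X : Type) (E : set R)
    (Z : random_field X E) (rho : X -> X -> R) : Prop :=
  forall x y, ('E_(rf_prob Z)[fun w => (rf_val Z x w * rf_val Z y w)%R])%E
              = (rho x y)%:E.

Definition symmetric_map (R : realType) (X : Type) (rho : X -> X -> R) : Prop :=
  forall x y, rho x y = rho y x.

Definition bounded_map (R : realType) (X : Type) (rho : X -> X -> R) : Prop :=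
  forall x y, rho x y \in `[-1, 1].

Definition positive_semidefinite (R : realType) (X : Type)
    (rho : X -> X -> R) : Prop :=
  forall (n : nat) (x : 'I_n -> X) (lambda : 'I_n -> R), (0 < n)%N ->
    0 <= \sum_(k < n) \sum_(l < n) lambda k * lambda l * rho (x k) (x l).

(* Main.v *)
(* Necessity: the expectation is a positive linear functional, so every
   inequality between the products [Z x w * Z y w] that holds pointwise passes
   to the covariance.  Failure of sufficiency: a point of the cube [-1,1]^3
   satisfies [a * b + b * c + c * a >= -1], since this expression is affine in
   each variable and the inequality holds at the vertices.  The Gram matrix of
   three unit vectors of the plane at mutual angles of 120 degrees has
   off-diagonal entries [-1/2], whose sum [-3/2] violates the corresponding
   inequality for covariances. *)
Require Import Defs.
From mathcomp Require Import all_boot all_order all_algebra.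
From mathcomp Require Import all_classical all_reals all_analysis.
From mathcomp Require Import measurable_realfun.
From mathcomp Require Import ring lra.

Set Implicit Arguments.
Unset Strict Implicit.
Unset Printing Implicit Defensive.

Local Open Scope classical_set_scope.
Local Open Scope ring_scope.

Import Order.TTheory GRing.Theory Num.Theory.

Lemma Lfun1_bounded (d : measure_display) (T : measurableType d)
    (R : realType) (P : probability T R) (X : T -> R) (M : R) :
  measurable_fun setT X -> (forall w, `|X w| <= M) -> X \in Lfun P 1.
Proof.
move=> mX XM; apply/Lfun1_integrable.
apply: (@le_integrable _ _ _ P setT measurableT _ (EFin \o cst M)).
- exact/measurable_EFinP.
- by move=> w _ /=; rewrite lee_fin (le_trans (XM w))// ler_norm.
- exact: finite_measure_integrable_cst.
Qed.

(** Linearity, by induction over the list of indices; integrability of every term is what makes the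
    expectation additive. *)
Lemma expectation_affine_combination (d : measure_display)
    (T : measurableType d) (R : realType) (P : probability T R) (I : finType)
    (c : R) (a : I -> R) (X : I -> T -> R) (e : I -> R) :
  (forall i, X i \in Lfun P 1) -> (forall i, 'E_P[X i]%E = (e i)%:E) ->
  'E_P[fun w => (c + \sum_i a i * X i w)%R]%E = (c + \sum_i a i * e i)%:E.
Proof.
move=> XL Xe.
have aXL i : a i \o* X i \in Lfun P 1.
  rewrite (_ : a i \o* X i = a i *: X i) ?rpredZ//.
  by apply/funext => w /=; rewrite mulrC.
have sumE (s : seq I) : 'E_P[(\sum_(i <- s) (a i \o* X i))%R]%E =
    (\sum_(i <- s) a i * e i)%:E.
  elim: s => [|i s IHs]; first by rewrite !big_nil expectation_cst.
  by rewrite !big_cons expectationD ?rpred_sum// expectationZl// IHs Xe.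
rewrite EFinD -(expectation_cst P c) -sumE -expectationD ?rpred_sum//; last first.
  exact: Lfun_cst.
congr expectation; apply/funext => w /=; rewrite fct_sumE.
by congr (_ + _); apply: eq_bigr => i _; rewrite mulrC.
Qed.

Section covariance.
Context (R : realType) (X : Type) (Z : random_field X `[(-1 : R), 1]%classic)
  (rho : X -> X -> R) (Zrho : is_noncentered_covariance Z rho).

Let rf_bounds (x : X) (w : rf_space Z) : -1 <= rf_val Z x w <= 1.
Proof. by have := @rf_valued _ _ _ Z x w; rewrite /= in_itv. Qed.

Let rf_prod_bound (x y : X) (w : rf_space Z) :
  `|rf_val Z x w * rf_val Z y w| <= 1.
Proof. by rewrite normrM mulr_ile1// ler_norml rf_bounds. Qed.

(** The transfer principle behind the bounds, positive semidefiniteness and the triangle inequality: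
    each is an instance for some [c], [a], [f], [g]. The products are bounded by 1, hence
    integrable. *)
Lemma covariance_affine_ge0 (I : finType) (c : R) (a : I -> R) (f g : I -> X) :
  (forall w, 0 <= c + \sum_i a i * (rf_val Z (f i) w * rf_val Z (g i) w)) ->
  0 <= c + \sum_i a i * rho (f i) (g i).
Proof.
move=> ge0; rewrite -lee_fin.
rewrite -(@expectation_affine_combination _ _ _ (rf_prob Z) _ c a
  (fun i w => rf_val Z (f i) w * rf_val Z (g i) w)) //; last first.
  move=> i; apply: (@Lfun1_bounded _ _ _ _ _ 1).
    exact: measurable_funM.
  exact: rf_prod_bound.
exact: expectation_ge0.
Qed.

Lemma covariance_symmetric : symmetric_map rho.
Proof.
move=> x y; apply: EFin_inj; rewrite -!Zrho.
by congr expectation; apply/funext => w; rewrite mulrC.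
Qed.

Lemma covariance_bounded : bounded_map rho.
Proof.
move=> x y; rewrite in_itv /=.
apply/andP; split.
(* A one-term sum with [c = 1] and coefficient 1, then -1, gives the lower, then the upper bound. *)
- have := @covariance_affine_ge0 unit 1 (fun=> 1) (fun=> x) (fun=> y).
  rewrite big_const card_unit /= addr0 mul1r -lerBlDl sub0r; apply => w.
  rewrite big_const card_unit /= addr0 mul1r -lerBlDl sub0r.
  by have := rf_prod_bound x y w; rewrite ler_norml => /andP[].
- have := @covariance_affine_ge0 unit 1 (fun=> -1) (fun=> x) (fun=> y).
  rewrite big_const card_unit /= addr0 mulN1r subr_ge0; apply => w.
  rewrite big_const card_unit /= addr0 mulN1r subr_ge0.
  by have := rf_prod_bound x y w; rewrite ler_norml => /andP[].
Qed.

Lemma covariance_positive_semidefinite : positive_semidefinite rho.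
Proof.
move=> n x lambda _.
(* Indexed by pairs, the pointwise sum is the square of [\sum_k lambda k * rf_val Z (x k) w]. *)
have := @covariance_affine_ge0 ('I_n * 'I_n)%type 0
  (fun p => lambda p.1 * lambda p.2) (x \o fst) (x \o snd).
rewrite add0r pair_bigA /=; apply=> w; rewrite add0r.
rewrite -(pair_bigA _ (fun k l => lambda k * lambda l *
  (rf_val Z (x k) w * rf_val Z (x l) w))) /=.
rewrite (eq_bigr (fun k => (lambda k * rf_val Z (x k) w) *
  \sum_l lambda l * rf_val Z (x l) w)).
  by rewrite -mulr_suml -expr2 sqr_ge0.
by move=> k _; rewrite mulr_sumr; apply: eq_bigr => l _; ring.
Qed.

Lemma covariance_triangle (x y z : X) : -1 <= rho x y + rho y z + rho z x.
Proof.
(* The two tuples, read in parallel, list the cyclic pairs. *)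
have h := @covariance_affine_ge0 'I_3 1 (fun=> 1)
  (tnth [tuple x; y; z]) (tnth [tuple y; z; x]).
move: h; rewrite !big_ord_recl big_ord0 /= !(tnth_nth x) /= => h.
suff : 0 <= 1 + (1 * rho x y + (1 * rho y z + (1 * rho z x + 0))) by lra.
apply: h => w; rewrite !big_ord_recl big_ord0 /= !(tnth_nth x) /=.
have := rf_bounds x w; have := rf_bounds y w; have := rf_bounds z w.
move: (rf_val Z x w) (rf_val Z y w) (rf_val Z z w) => a b c.
move=> /andP[c1 c2] /andP[b1 b2] /andP[a1 a2].
(* The sum of these two products is [2 * (1 + a * b + b * c + c * a)]. *)
have p1 : 0 <= (1 + a) * ((1 + b) * (1 + c)) by rewrite !mulr_ge0//; lra.
have p2 : 0 <= (1 - a) * ((1 - b) * (1 - c)) by rewrite !mulr_ge0//; lra.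
lra.
Qed.

End covariance.

(** Exchanging sums turns the quadratic form into [c] times a sum of squares, one per coordinate. *)
Lemma gram_positive_semidefinite (R : realType) (X : Type) (I : finType)
    (c : R) (v : X -> I -> R) : 0 <= c ->
  positive_semidefinite (fun x y => c * \sum_i v x i * v y i).
Proof.
move=> c0 n x lambda _.
rewrite (_ : \sum_(k < n) _ = c * \sum_i (\sum_k lambda k * v (x k) i) ^+ 2).
  by rewrite mulr_ge0// sumr_ge0// => i _; rewrite sqr_ge0.
under [in RHS]eq_bigr do rewrite expr2 mulr_suml.
rewrite [in RHS]exchange_big [in RHS]mulr_sumr; apply: eq_bigr => k _ /=.
under [in RHS]eq_bigr do rewrite mulr_sumr.
rewrite [in RHS]exchange_big [in RHS]mulr_sumr; apply: eq_bigr => l _ /=.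
by rewrite !mulr_sumr; apply: eq_bigr => i _; ring.
Qed.

(* Up to the factor [1/2], the Gram matrix of [e_0 - e_1], [e_1 - e_2] and
   [e_2 - e_0], which are three vectors at mutual angles of 120 degrees. *)
Definition triangle_kernel (R : realType) (i j : 'I_3) : R :=
  2^-1 * \sum_(m < 3) ((i == m)%:R - (ordS i == m)%:R) *
                      ((j == m)%:R - (ordS j == m)%:R).

(** Each vector has squared norm 2; two distinct ones share a single nonzero coordinate, with
    opposite signs, so their inner product is -1. *)
Lemma triangle_kernelE (R : realType) (i j : 'I_3) :
  triangle_kernel R i j = if i == j then 1 else - 2^-1.
Proof.
rewrite /triangle_kernel !big_ord_recl big_ord0.
case: i j => [[|[|[|//]]] ?] [[|[|[|//]]] ?]; rewrite -!val_eqE /=; lra.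
Qed.

Theorem theorem21 (R : realType) :
  (forall (X : Type) (rho : X -> X -> R),
     (exists Z : random_field X `[(-1 : R), 1]%classic,
        is_noncentered_covariance Z rho) ->
     [/\ symmetric_map rho, bounded_map rho & positive_semidefinite rho])
  /\
  (exists (X : Type) (rho : X -> X -> R),
     [/\ symmetric_map rho, bounded_map rho & positive_semidefinite rho] /\
     ~ (exists Z : random_field X `[(-1 : R), 1]%classic,
          is_noncentered_covariance Z rho)).
Proof.
split=> [X rho [Z Zrho]|].
  split; [exact: covariance_symmetric Zrho | exact: covariance_bounded Zrho |
          exact: covariance_positive_semidefinite Zrho].
exists 'I_3, (triangle_kernel R); split; last first.
  move=> [Z Zrho].
  have := covariance_triangle Zrho ord0 (ordS ord0) (ordS (ordS ord0)).
  by rewrite !triangle_kernelE -!val_eqE /=; lra.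
split.
- by move=> i j; rewrite !triangle_kernelE eq_sym.
- by move=> i j; rewrite triangle_kernelE in_itv /=; case: ifP; lra.
(* Here the kernel is used in its defining Gram form, not through its entries. *)
- by apply: gram_positive_semidefinite; rewrite invr_ge0.
Qed.
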